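(* Let $f\colon X\to[-\infty,+\infty]$ be a densely defined lower semicontinuous functional, let $K\in\mathbb R$ and $N<0$, and let $(y_t)_{t\in(0,T)}$ be an $\mathrm{EVI}_{K,N}$ gradient curve for $f$. Then the curve $(y_t)_{t\in(0,T)}$ is locally Lipschitz on $(0,T)$.
   Context: Setting. $(X,d)$ is a metric space, not necessarily complete, which is strictly intrinsic (any two points are joined by a geodesic in $X$) and whose metric completion is geodesic (complete and strictly intrinsic). A geodesic is a continuous curve $\gamma\colon[0,1]\to X$ with $d(\gamma_s,\gamma_t)=|t-s|\,d(\gamma_0,\gamma_1)$ for all $s,t\in[0,1]$. $\mathcal D[f]=\{x: f(x)\ne\pm\infty\}\neq\emptyset$ and $\mathcal D^\star[f]=\{x: f(x)<+\infty\}$; ''densely defined'' means that $\mathcal D[f]$ is dense in $X$. For $N<0$, $f_N:=e^{-f/N}$, with $f_N=0$ where $f=-\infty$ and $f_N=+\infty$ where $f=+\infty$. $\frac{\mathrm d^+}{\mathrm dt}h(t):=\limsup_{\epsilon\downarrow0}\frac{h(t+\epsilon)-h(t)}{\epsilon}$. For $\theta\ge0$: $\mathfrak s_{K,N}(\theta)=\frac{\sin(\theta\sqrt{K/N})}{\sqrt{K/N}}$ if $K<0$, $=\theta$ if $K=0$, $=\frac{\sinh(\theta\sqrt{-K/N})}{\sqrt{-K/N}}$ if $K>0$. $\mathrm{EVI}_{K,N}$ gradient curve for $f$: a continuous curve $(y_t)_{t\in(0,T)}\subset\mathcal D[f]$, $T\in(0,+\infty]$, such that $$\frac{\mathrm d^+}{\mathrm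 dt}\Big[\mathfrak s_{K,N}\big(\tfrac{d(y_t,z)}2\big)^2\Big]+K\,\mathfrak s_{K,N}\big(\tfrac{d(y_t,z)}2\big)^2\le\frac N2\Big(1-\frac{f_N(z)}{f_N(y_t)}\Big)$$ for every $z\in\mathcal D^\star[f]$ and every $t\in(0,T)$, with $d(y_t,z)<\pi\sqrt{N/K}$ if $K<0$. *)

(* Defs.v *)
From HB Require Import structures.
From mathcomp Require Import all_boot all_order all_algebra.
From mathcomp Require Import all_classical all_reals all_analysis.

Set Implicit Arguments.
Unset Strict Implicit.
Unset Printing Implicit Defensive.

Import Order.TTheory GRing.Theory Num.Theory.
Import numFieldNormedType.Exports.

Local Open Scope classical_set_scope.
Local Open Scope ring_scope.

Section MetricSpaces.
Context {R : realType}.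

(* Curves are total functions on R; only their values on the relevant interval
   matter. *)
Definition geodesic (X : metricType R) (g : R -> X) :=
  {within `[0, 1], continuous g} /\
  forall s t : R, s \in `[0, 1] -> t \in `[0, 1] ->
    mdist (g s) (g t) = `|t - s| * mdist (g 0) (g 1).

Definition strictly_intrinsic (X : metricType R) :=
  forall x y : X, exists g : R -> X, [/\ geodesic g, g 0 = x & g 1 = y].

(* [exists l, F --> l] is used instead of [cvg F], which requires a pointed
   type. *)
Definition metric_complete (X : metricType R) :=
  forall F : set_system X, ProperFilter F -> cauchy F -> exists l : X, F --> l.

Definition geodesic_space (X : metricType R) :=
  metric_complete X /\ strictly_intrinsic X.

Definition is_completion (X Y : metricType R) (i : X -> Y) :=
  [/\ metric_complete Y,
      forall x x', mdist (i x) (i x') = mdist x x' &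
      dense (range i)].

(* The completion is unique up to isometry, so it does not matter which one is
   considered. *)
Definition has_geodesic_completion (X : metricType R) :=
  exists (Y : metricType R) (i : X -> Y), is_completion i /\ geodesic_space Y.

Definition locally_lipschitz_on (X : metricType R) (A : set R) (y : R -> X) :=
  forall t, A t -> exists (L : R) (U : set R), nbhs t U /\
    forall r s, (U `&` A) r -> (U `&` A) s ->
      mdist (y r) (y s) <= L * `|r - s|.

End MetricSpaces.

Section EVI.
Context {R : realType}.

Definition sinh (x : R) : R := (expR x - expR (- x)) / 2.

(* Used for N < 0 only: K / N > 0 exactly when K < 0. *)
Definition sKN (K N theta : R) : R :=
  if K < 0 then sin (theta * Num.sqrt (K / N)) / Num.sqrt (K / N)
  else if K == 0 then theta
  else sinh (theta * Num.sqrt (- K / N)) / Num.sqrt (- K / N).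

Definition upper_right_derivative (h : R -> R) (t : R) : \bar R :=
  limf_esup (fun e => ((h (t + e) - h t) / e)%:E) 0^'+.

Variable X : metricType R.
Implicit Types f : X -> \bar R.

Definition dom f : set X := [set x | f x \is a fin_num].

Definition dom_star f : set X := [set x | (f x < +oo)%E].

Definition fN f (N : R) (x : X) : \bar R :=
  match f x with
  | r%:E => (expR (- r / N)%R)%:E
  | +oo => +oo
  | -oo => 0%R%:E
  end%E.

Definition time_interval (T : \bar R) : set R :=
  [set t | 0 < t /\ (t%:E < T)%E].

(* Continuity is asked at each point of the open interval (0, T), which is the
   same as continuity of the restriction. In the inequality only the upper
   derivative on the left can be infinite, since f is finite at [y t] and
   [fN f N z] is finite on [dom_star f]. *)
Definition EVI_gradient_curve f (K N : R) (T : \bar R) (y : R -> X) :=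
  [/\ forall t, time_interval T t -> {for t, continuous y},
      forall t, time_interval T t -> dom f (y t) &
      forall z t, dom_star f z -> time_interval T t ->
        (K < 0 -> mdist (y t) z < pi * Num.sqrt (N / K)) ->
        (upper_right_derivative (fun s => (sKN K N (mdist (y s) z / 2) ^+ 2)%R) t
           + (K * sKN K N (mdist (y t) z / 2) ^+ 2)%R%:E
         <= (N / 2)%R%:E * (1 - fN f N z / fN f N (y t)))%E].

End EVI.

(* Main.v *)
Require Import Defs.
From mathcomp Require Import all_boot all_order all_algebra.
From mathcomp Require Import all_classical all_reals all_analysis.
From mathcomp Require Import lra ring.

(* Write [g t = f_N (y t)] and [S r s = sKN (d (y r, y s) / 2) ^ 2]. Testing the
   inequality against points of the curve itself, lower semicontinuity makes [g]
   nonincreasing, and a Gronwall argument gives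
   [S t s <= C (g s - g t) (t - s)] for nearby [s <= t]. So it remains to see
   that [g] is locally Lipschitz. Integrating the inequality over [s, t] once
   against [y s] and once against [y t] and adding, the distance terms cancel up
   to a term of order [K], and what is left is a perturbed Hermite-Hadamard
   inequality: in the time parameter [tau] with [d tau = dt / g], the mean of
   [g] over [s, t] is at most [(g s + g t) / 2] plus an error. For exact
   Hermite-Hadamard this is convexity, which gives local Lipschitz continuity of
   the bounded function [g]; the perturbed version is handled on equidistant
   times, with Riemann sums instead of integrals. *)

Set Implicit Arguments.
Unset Strict Implicit.
Unset Printing Implicit Defensive.

Import Order.TTheory GRing.Theory Num.Theory.
Import numFieldNormedType.Exports.

Local Open Scope classical_set_scope.
Local Open Scope ring_scope.

(** * A discrete perturbed Hermite-Hadamard inequality and its slope bound *)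

Section DiscreteHermiteHadamard.
Context {R : realType}.
Variables (w e : nat -> R) (m : nat) (p P c : R).

Local Notation W n := (\sum_(j < n) w j).
Local Notation E n := (\sum_(j < n) w j * e j).

Hypotheses (p_gt0 : 0 < p) (c_ge0 : 0 <= c).
Hypothesis w_ge : forall j, (j <= m)%N -> p <= w j.
Hypothesis w_le : forall j, (j <= m)%N -> w j <= P.
Hypothesis w_noninc : forall j, (j < m)%N -> w j.+1 <= w j.
Hypothesis e_ge0 : forall j, (j <= m)%N -> 0 <= e j.
Hypothesis e0 : e 0%N = 0.
Hypothesis hermite_hadamard : forall n, (0 < n)%N -> (n <= m)%N ->
  2 * E n <= e n * W n * (1 + c * n%:R).

Let sum_w_ge n : (n <= m.+1)%N -> p * n%:R <= W n.
Proof.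
elim: n => [|n IH] nm; first by rewrite big_ord0 mulr0.
by rewrite big_ord_recr/= -natr1 mulrDr mulr1 lerD ?IH ?w_ge// ltnW.
Qed.

Let sum_w_le n : (n <= m.+1)%N -> W n <= P * n%:R.
Proof.
elim: n => [|n IH] nm; first by rewrite big_ord0 mulr0.
by rewrite big_ord_recr/= -natr1 mulrDr mulr1 lerD ?IH ?w_le// ltnW.
Qed.

Let P_gt0 : 0 < P.
Proof. exact: lt_le_trans p_gt0 (le_trans (w_ge (leq0n m)) (w_le (leq0n m))). Qed.

(* In the unperturbed case [c = 0] the hypothesis makes
   [E n / (W n * W n.+1)] nondecreasing, because [w] is nonincreasing. *)
Let sum_we_ge n : 2 * c * P / p * m%:R <= 1 / 2 -> (1 < n)%N -> (n <= m)%N ->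
  p * e 1%N / (6 * P ^+ 2) * (1 - 2 * c * P / p * n%:R) * (W n * W n.+1) <= E n.
Proof.
set D := 2 * c * P / p; set b := p * _ / _ => Dm.
have pP : p <= P by apply: le_trans (w_ge (leq0n m)) (w_le (leq0n m)).
have D_ge0 : 0 <= D by rewrite /D !mulr_ge0// ?invr_ge0 ltW.
have cD : 2 * c <= D.
  by rewrite /D -mulrA ler_peMr ?mulr_ge0// ler_pdivlMr// mul1r.
have Dle n' : (n' <= m)%N -> D * n'%:R <= 1 / 2.
  by move=> n'm; apply: le_trans Dm; rewrite ler_wpM2l// ler_nat.
have b_ge0 : (1 < n)%N -> (n <= m)%N -> 0 <= b.
  move=> n1 nm; rewrite /b divr_ge0 ?mulr_ge0 ?exprn_ge0// ?(ltW p_gt0) ?(ltW P_gt0)//.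
  by apply: e_ge0; rewrite (leq_trans _ nm)// ltnW.
elim: n b_ge0 => [_|[_ _|[_ b_ge0|n IH b_ge0]]] // _ nm.
  have m1 : (1 <= m)%N by rewrite ltnW.
  (* Base case: since [e 0 = 0], [E 2] is [w 1 * e 1], which is at least [p * e 1]. The [6 * P ^+ 2]
     in [b] is there to bound [W 2 * W 3]. *)
  rewrite [E 2]big_ord_recr big_ord_recr big_ord0/= add0r e0 mulr0 add0r.
  have be : b * (6 * P ^+ 2) = p * e 1%N.
    by rewrite /b divfK// mulf_neq0// ?pnatr_eq0// expf_eq0/= gt_eqF.
  have w1 := w_ge m1; have e1 := e_ge0 m1.
  have W2 : W 2 <= P * 2 by apply: sum_w_le; rewrite ltnS ltnW.
  have W3 : W 3 <= P * 3 by apply: sum_w_le.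
  have W2g : p * 2 <= W 2 by apply: sum_w_ge; rewrite ltnS ltnW.
  have W3g : p * 3 <= W 3 by apply: sum_w_ge.
  have bg := b_ge0 isT nm.
  have WW : W 2 * W 3 <= 6 * P ^+ 2.
    have -> : 6 * P ^+ 2 = (P * 2) * (P * 3) by ring.
    by apply: ler_pM => //; apply: le_trans W2g || apply: le_trans W3g;
      rewrite mulr_ge0// ltW.
  apply: (@le_trans _ _ (b * (6 * P ^+ 2))).
    rewrite -mulrA ler_wpM2l//; apply: le_trans WW.
    rewrite ler_piMl//; last by rewrite gerBl mulr_ge0.
    rewrite mulr_ge0//; [apply: le_trans W2g|apply: le_trans W3g];
      by rewrite mulr_ge0// ltW.
  by rewrite be ler_wpM2r.
have nm1 : (n.+2 <= m)%N by rewrite ltnW.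
have bg := b_ge0 isT nm.
have {}IH := IH (fun _ _ => bg) isT nm1.
have HH := hermite_hadamard (n := n.+2) isT nm1.
rewrite [E n.+3]big_ord_recr [W n.+4]big_ord_recr/= [W n.+3]big_ord_recr/=.
rewrite [W n.+3]big_ord_recr/= in IH.
have Wg : p * n.+2%:R <= W n.+2 by rewrite sum_w_ge// leqW.
have wn := w_noninc nm.
have wg := w_ge nm1; have wg' := w_ge nm; have wl := w_le nm1.
have eg := e_ge0 nm1.
have DN : D * n.+3%:R <= 1 / 2 by exact: Dle.
have eN : D * n.+3%:R = D * n.+2%:R + D by rewrite -natr1 mulrDr mulr1.
rewrite eN in DN *.
have D2 : D * n.+2%:R <= 1 / 2 by exact: Dle.
have cN : c * n.+2%:R <= 1 / 2.
  apply: le_trans D2; rewrite ler_wpM2r//; lra.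
(* This dictates the value of [D]: the perturbation must be absorbed by [D * W n], knowing only
   [W n >= p * n] and [w <= P]. *)
have DW : 2 * w n.+2 * (c * n.+2%:R) <= D * W n.+2.
  apply: (@le_trans _ _ (D * (p * n.+2%:R))); last by rewrite ler_wpM2l.
  have -> : D * (p * n.+2%:R) = 2 * P * (c * n.+2%:R).
    rewrite /D; field; by rewrite gt_eqF.
  by rewrite ler_wpM2r ?mulr_ge0// ler_wpM2l.
have N0 : 0 < n.+2%:R :> R by rewrite ltr0n.
have W0 : 0 < W n.+2 by apply: lt_le_trans Wg; rewrite mulr_gt0.
have cn0 : 0 <= c * n.+2%:R by rewrite mulr_ge0.
have Dn0 : 0 <= D * n.+2%:R by rewrite mulr_ge0.
clearbody b.
move: (W n.+2) (E n.+2) (w n.+2) (w n.+3) (e n.+2) (c * n.+2%:R)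
  (D * n.+2%:R) IH HH Wg wn wg wg' wl eg DN D2 cN DW W0 cn0 Dn0 =>
  V F w0 w1 en cn Dn IH HH Wg wn wg wg' wl eg DN D2 cN DW V0 cn0 Dn0.
have w0_gt0 : 0 < w0 by exact: lt_le_trans wg.
have w1_gt0 : 0 < w1 by exact: lt_le_trans wg'.
have w0_ge0 := ltW w0_gt0; have w1_ge0 := ltW w1_gt0; have V_ge0 := ltW V0.
have D1 : 0 <= 1 - D by lra.
have Dn1 : 0 <= 1 - Dn by lra.
have F0 : 0 <= F.
  by apply: le_trans IH; rewrite !mulr_ge0// addr_ge0.
rewrite -(ler_pM2r V0).
(* The factor [1 + cn] moves to the other side as [1 - cn], because [(1 + cn) * (1 - cn) <= 1]. *)
have s1 : 2 * F * (1 - cn) <= en * V.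
  apply: (@le_trans _ _ (en * V * (1 + cn) * (1 - cn))).
    by rewrite ler_wpM2r// subr_ge0; lra.
  rewrite -mulrA ler_piMr ?mulr_ge0//.
  have : 0 <= cn * cn by rewrite mulr_ge0.
  lra.
have s2 : F * (V + 2 * w0 - D * V) <= (F + w0 * en) * V.
  have : w0 * (2 * F * (1 - cn)) <= w0 * (en * V) by rewrite ler_wpM2l// ltW.
  have : F * (2 * w0 * cn) <= F * (D * V) by rewrite ler_wpM2l.
  lra.
apply: le_trans s2.
(* Monotonicity of the weights enters here, through [w1 <= w0]: one step costs only the factor
   [1 - D]. *)
have s3 : (V + w0 + w1) * (1 - D) <= V + 2 * w0 - D * V.
  have : 0 <= D * w0 by rewrite mulr_ge0// ltW.
  have : 0 <= D * w1 by rewrite mulr_ge0// ltW.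
  lra.
apply: (@le_trans _ _ (F * ((V + w0 + w1) * (1 - D)))); last first.
  by rewrite ler_wpM2l.
apply: (@le_trans _ _ (b * (1 - Dn) * (V * (V + w0)) * ((V + w0 + w1) * (1 - D)))); last first.
  by rewrite ler_wpM2r// mulr_ge0// !addr_ge0.
have -> : b * (1 - (Dn + D)) * ((V + w0) * (V + w0 + w1)) * V =
  b * (V * (V + w0)) * (V + w0 + w1) * (1 - (Dn + D)) by ring.
have -> : b * (1 - Dn) * (V * (V + w0)) * ((V + w0 + w1) * (1 - D)) =
  b * (V * (V + w0)) * (V + w0 + w1) * ((1 - Dn) * (1 - D)) by ring.
rewrite ler_wpM2l// ?mulr_ge0 ?addr_ge0//.
(* The losses add up linearly: [1 - (Dn + D) <= (1 - Dn) * (1 - D)]. *)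
have : 0 <= Dn * D by rewrite mulr_ge0.
lra.
Qed.

(** Discrete counterpart, up to a constant, of the monotonicity of the difference quotients of a
    convex function vanishing at 0. The sum [E m] is squeezed between the quadratic lower bound
    [sum_we_ge] and the hypothesis for [n = m]; dividing by [W m] leaves a bound linear in [m]. *)
Lemma discrete_slope_bound : (0 < m)%N -> 2 * c * P / p * m%:R <= 1 / 2 ->
  m%:R * e 1%N <= 8 * P ^+ 2 / p ^+ 2 * e m.
Proof.
move=> m0 Dm.
have pP : p <= P by apply: le_trans (w_ge (leq0n m)) (w_le (leq0n m)).
have C1 : 1 <= P ^+ 2 / p ^+ 2.
  by rewrite ler_pdivlMr ?exprn_gt0// mul1r ler_pXn2r// nnegrE ltW.
(* The lower bound on [E m] starts at [m = 2]; for [m = 1] the claim only says that the constant is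
   at least 1. *)
have [m1|m1] := leqP m 1.
  have -> : m = 1%N by apply/eqP; rewrite eqn_leq m1 m0.
  by rewrite mul1r ler_peMl ?e_ge0// -mulrA; lra.
have := sum_we_ge Dm m1 (leqnn m).
have := hermite_hadamard m0 (leqnn m).
set D := 2 * c * P / p in Dm *; set b := p * _ / _ => HH Em.
have cD : 2 * c <= D.
  by rewrite /D -mulrA ler_peMr ?mulr_ge0// ler_pdivlMr// mul1r.
have cm : c * m%:R <= 1 / 4.
  have : 2 * c * m%:R <= D * m%:R by rewrite ler_wpM2r.
  lra.
have M0 : 0 < m%:R :> R by rewrite ltr0n.
have Wm : 0 < W m.
  by apply: lt_le_trans (sum_w_ge (leqnSn m)); rewrite mulr_gt0.
have Wm1 : p * m%:R <= W m.+1.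
  by apply: le_trans (sum_w_ge (leqnn m.+1)); rewrite ler_wpM2l ?ler_nat// ltW.
have em := e_ge0 (leqnn m).
have b0 : 0 <= b.
  by rewrite /b divr_ge0 ?mulr_ge0 ?exprn_ge0// ?(ltW p_gt0) ?(ltW P_gt0)// e_ge0.
have W1 : 0 <= W m.+1 by apply: le_trans Wm1; rewrite mulr_ge0// ltW.
have key : b * W m.+1 <= e m * (1 + 1 / 4).
  rewrite -(ler_pM2r Wm).
  have h1 : b * (W m * W m.+1) <= 2 * E m.
    have : b * (1 / 2) * (W m * W m.+1) <= E m.
      apply: le_trans Em; rewrite ler_wpM2r ?(mulr_ge0 (ltW Wm))// ler_wpM2l//; lra.
    lra.
  have h2 : e m * W m * (1 + c * m%:R) <= e m * W m * (1 + 1 / 4).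
    by rewrite ler_wpM2l ?lerD2l// mulr_ge0// ltW.
  lra.
have bb : b * (p * m%:R) <= e m * (1 + 1 / 4).
  by apply: le_trans key; rewrite ler_wpM2l.
(* Undoing the definition of [b] costs a factor 6, and [6 * (1 + 1 / 4) <= 8]. *)
have -> : m%:R * e 1%N = 6 * P ^+ 2 / p ^+ 2 * (b * (p * m%:R)).
  rewrite /b; field; by rewrite !gt_eqF.
apply: (@le_trans _ _ (6 * P ^+ 2 / p ^+ 2 * (e m * (1 + 1 / 4)))).
  by rewrite ler_wpM2l// divr_ge0// ?mulr_ge0 ?exprn_ge0 ?ltW.
have : 0 <= P ^+ 2 / p ^+ 2 * e m by rewrite mulr_ge0// divr_ge0// exprn_ge0 ?ltW.
lra.
Qed.

End DiscreteHermiteHadamard.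

(** * Upper right Dini derivatives: mean value and Gronwall inequalities *)

(** The slack [e] expresses that the limsup of the right difference quotients is at most [B],
    without extended reals. *)
Definition upper_dini_le {R : realType} (phi : R -> R) (r B : R) :=
  forall e, 0 < e -> \forall h \near 0^'+, phi (r + h) - phi r <= (B + e) * h.

Section Dini.
Context {R : realType}.
Implicit Types (phi : R -> R) (a b A B k : R).

Lemma upper_dini_le_weaken phi r B B' :
  B <= B' -> upper_dini_le phi r B -> upper_dini_le phi r B'.
Proof.
move=> BB' dB e e0; have := dB _ e0.
apply: filter_app; near=> h => /le_trans; apply.
by rewrite ler_wpM2r ?lerD2r.
Unshelve. all: by end_near. Qed.

(** Continuous induction: the supremum of the points where the bound with slope [B + d] holds
    satisfies it by continuity, and below [b] the Dini bound would carry it further right. *)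
Lemma upper_dini_mean_value phi a b B : a <= b ->
  (forall r, a <= r <= b -> {for r, continuous phi}) ->
  (forall r, a <= r < b -> upper_dini_le phi r B) ->
  phi b - phi a <= B * (b - a).
Proof.
move=> ab phic phiB; apply/ler_addgt0Pr => e e0.
(* The extra 1 allows [a = b]; the slack accumulated over [[a, b]] is then at most [e]. *)
pose d := e / (b - a + 1).
have ba1 : 0 < b - a + 1 by rewrite ltr_pwDr// subr_ge0.
have d0 : 0 < d by rewrite divr_gt0.
suff : phi b - phi a <= (B + d) * (b - a).
  move/le_trans; apply; rewrite mulrDl lerD2l /d mulrAC ler_pdivrMr//.
  by rewrite ler_wpM2l ?lerDl// ltW.
pose E := [set r | a <= r <= b /\ phi r - phi a <= (B + d) * (r - a)].
have Ea : E a by split; rewrite ?lexx ?ab// !subrr mulr0.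
have Eb : ubound E b by move=> r [/andP[]].
have supE : has_sup E by split; [exists a|exists b].
pose s := sup E.
have as_ : a <= s by by apply: ub_le_sup; first exact: supE.2.
have sb : s <= b by exact: ge_sup supE.1 Eb.
have sasb : a <= s <= b by rewrite as_.
have Es : E s.
  split=> //; apply/ler_addgt0Pr => x x0.
  have cs : {for s, continuous (fun r => phi r - phi a - (B + d) * (r - a))}.
    move=> /=; apply: cvgB; [apply: cvgB|apply: cvgM].
    - exact: phic.
    - exact: cvg_cst.
    - exact: cvg_cst.
    - by apply: cvgB; [exact: cvg_id|exact: cvg_cst].
  move/cvgrPdist_lt : cs => /(_ _ x0) [z /= z0 near_s].
  have [r Er sr] := sup_adherent z0 supE.
  have rs : r <= s by by apply: ub_le_sup; first exact: supE.2.
  have := near_s r; rewrite /ball_/= => /(_ _)/wrap[].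
    by rewrite ger0_norm ?subr_ge0// ltrBlDr -ltrBlDl.
  have [_ +] := Er.
  by rewrite ltr_norml => ? /andP[_]; lra.
have [bs|sb'] := leP b s.
  have eb : b = s by apply/eqP; rewrite eq_le bs.
  by rewrite eb; exact: Es.2.
have sasb' : a <= s < b by rewrite as_.
have near_h := phiB _ sasb' _ d0.
near ((0 : R)^'+) => h.
have h0 : 0 < h by [].
have : E (s + h).
  split.
    rewrite (le_trans as_) ?lerDl ?(ltW h0)//= -lerBrDl.
    near: h; apply: nbhs_right_le; by rewrite subr_gt0.
  have : phi (s + h) - phi s <= (B + d) * h by near: h.
  case: Es => _; lra.
move=> Esh; have := ub_le_sup supE.2 Esh; rewrite -/s; lra.
Unshelve. all: by end_near. Qed.

Lemma upper_dini_gronwall phi a b A k : 0 <= A -> 0 <= k ->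
  k * (b - a) <= 1 / 2 -> a <= b ->
  (forall r, a <= r <= b -> {for r, continuous phi}) ->
  (forall r, a <= r < b -> upper_dini_le phi r (A + k * phi r)) ->
  (forall r, a <= r <= b -> 0 <= phi r) -> phi a = 0 ->
  phi b <= 2 * A * (b - a).
Proof.
move=> A0 k0 kab ab phic phid phi0 phia.
have [|m mab phi_max] := @EVT_max _ phi a b ab.
  apply: continuous_in_subspaceT => r; rewrite inE/= in_itv/= => rab.
  exact: phic.
move: mab; rewrite in_itv/= => /andP[am mb].
have phi_le r : a <= r <= b -> phi r <= phi m.
  by move=> rab; apply: phi_max; rewrite in_itv.
have : phi m - phi a <= (A + k * phi m) * (m - a).
  apply: upper_dini_mean_value => // r /andP[ar rm].
    by apply: phic; rewrite ar (le_trans rm).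
  have rb : r < b by exact: lt_le_trans mb.
  apply: upper_dini_le_weaken (phid r _); last by rewrite ar.
  by rewrite lerD2l ler_wpM2l// phi_le// ar ltW.
have phim : 0 <= phi m by apply: phi0; rewrite am.
rewrite phia subr0 => h1.
have h2 : (A + k * phi m) * (m - a) <= (A + k * phi m) * (b - a).
  by rewrite ler_wpM2l ?addr_ge0 ?mulr_ge0// lerD2r.
have h3 : k * (b - a) * phi m <= 1 / 2 * phi m by rewrite ler_wpM2r.
have : phi b <= phi m by rewrite phi_le// ab lexx.
lra.
Qed.

End Dini.

(** * The evolution variational inequality tested along the curve, for abstract real functions [S]
    and [g] *)

Section SelfEVI.
Context {R : realType}.
Variables (S : R -> R -> R) (g : R -> R) (a b c k : R).

Local Notation I := [set r | a <= r <= b].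

Hypotheses (c_gt0 : 0 < c) (k_ge0 : 0 <= k) (kab : k * (b - a) <= 1 / 2).
Hypothesis S_ge0 : forall r s, I r -> I s -> 0 <= S r s.
Hypothesis Sxx : forall r, I r -> S r r = 0.
Hypothesis S_sym : forall r s, I r -> I s -> S r s = S s r.
Hypothesis S_cont : forall r s, I r -> I s -> {for r, continuous (S^~ s)}.
Hypothesis g_gt0 : forall r, I r -> 0 < g r.
Hypothesis g_noninc : forall r s, I r -> I s -> r <= s -> g s <= g r.
Hypothesis S_evi : forall r s, I r -> r < b -> I s ->
  upper_dini_le (S^~ s) r (c * (g s / g r - 1) + k * S r s).

(** Gronwall from [s] to [t]: as [g] is nonincreasing, [g s / g r] is at most its value at [r = t],
    so the driving term is bounded by a constant. *)
Lemma self_evi_speed s t : I s -> I t -> s <= t ->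
  S t s <= 2 * (c * (g s / g t - 1)) * (t - s).
Proof.
move=> Is It st; have [/andP[as_ sb] /andP[at_ tb]] := (Is, It).
have sub r : s <= r <= t -> I r.
  by move=> /andP[sr rt] /=; rewrite (le_trans as_)//= (le_trans rt).
apply: (@upper_dini_gronwall _ (S^~ s) s t _ k) => //.
- rewrite mulr_ge0 ?(ltW c_gt0)// subr_ge0 ler_pdivlMr ?g_gt0// mul1r.
  exact: g_noninc.
- by apply: le_trans kab; rewrite ler_wpM2l// lerB.
- by move=> r /sub Ir; exact: S_cont.
- move=> r /andP[sr rt]; have Ir : I r by apply: sub; rewrite sr ltW.
  apply: upper_dini_le_weaken (S_evi Ir (lt_le_trans rt tb) Is).
  rewrite lerD2r ler_wpM2l ?(ltW c_gt0)// lerD2r.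
  by rewrite ler_wpM2l ?(ltW (g_gt0 _))// lef_pV2 ?posrE ?g_gt0// g_noninc// ltW.
- by move=> r /sub Ir; exact: S_ge0.
- exact: Sxx.
Qed.

(* Adding the integrated inequality with endpoint [t - n * h] to the one with
   endpoint [t] cancels the two occurrences of [S t (t - n * h)]. *)
Lemma self_evi_hermite_hadamard t h n : (0 < n)%N -> 0 < h -> t <= b ->
  a <= t - n%:R * h ->
  2 * (\sum_(j < n) (g (t - j%:R * h))^-1 * (g (t - j%:R * h) - g t)) <=
  (g (t - n%:R * h) - g t) * (\sum_(j < n) (g (t - j%:R * h))^-1) +
  4 * k * (g t)^-1 * (g (t - n%:R * h) - g t) * n%:R ^+ 2 * h.
Proof.
move=> n0 h0 tb an.
set s := t - n%:R * h; set e := g s - g t.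
have nh0 : 0 < n%:R * h by rewrite mulr_gt0// ltr0n.
have st : s <= t by rewrite gerBl ltW.
have Is : I s by rewrite /= an (le_trans st).
have It : I t by rewrite /= tb (le_trans an).
have sub r : s <= r <= t -> I r.
  by move=> /andP[sr rt] /=; rewrite (le_trans an)//= (le_trans rt).
have gt0 := g_gt0 It; have gs0 := g_gt0 Is.
have e0 : 0 <= e by rewrite subr_ge0 g_noninc.
(* A bound for [S] on all of [[s, t]], from [self_evi_speed]. It controls the term in [k] and, being
   proportional to [e], gives an error of the required form. *)
pose M := 2 * c * (g t)^-1 * e * (n%:R * h).
have S_le_M r r' : s <= r -> r <= r' -> r' <= t -> S r' r <= M.
  move=> sr rr' r't.
  have Ir : I r by apply: sub; rewrite sr (le_trans rr').
  have Ir' : I r' by apply: sub; rewrite r't (le_trans sr).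
  apply: le_trans (self_evi_speed Ir Ir' rr') _.
  have gr0 := g_gt0 Ir; have gr'0 := g_gt0 Ir'.
  have g1 : g r <= g s by exact: g_noninc.
  have g2 : g t <= g r' by exact: g_noninc.
  have g3 : g r' <= g r by exact: g_noninc.
  have q : g r / g r' - 1 <= (g t)^-1 * e.
    rewrite /e mulrBr mulVf ?gt_eqF// lerD2r mulrC.
    by rewrite ler_pM ?invr_ge0 ?(ltW gr0) ?(ltW gr'0)// lef_pV2.
  have q0 : 0 <= g r / g r' - 1 by rewrite subr_ge0 ler_pdivlMr// mul1r.
  have -> : M = 2 * (c * ((g t)^-1 * e)) * (n%:R * h) by rewrite /M; ring.
  apply: ler_pM => //.
  - by rewrite !mulr_ge0// ltW.
  - by rewrite subr_ge0.
  - by rewrite ler_wpM2l// ler_wpM2l// ltW.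
  - have : n%:R * h = t - s by rewrite /s; ring.
    lra.
have S_le_M' r r' : s <= r <= t -> s <= r' <= t -> S r r' <= M.
  move=> rst r'st; have [/andP[sr rt] /andP[sr' r't]] := (rst, r'st).
  have [rr'|/ltW r'r] := leP r r'; last exact: S_le_M.
  by rewrite S_sym; [exact: S_le_M|exact: sub|exact: sub].
(* The times run backwards, from [u 0 = t] to [u n = s]. *)
pose u (j : nat) := t - j%:R * h.
have u_in j : (j <= n)%N -> s <= u j <= t.
  move=> jn; rewrite /u gerBl mulr_ge0 ?(ltW h0)//= andbT lerD2l lerN2.
  by rewrite ler_wpM2r ?(ltW h0)// ler_nat.
have uS j : u j = u j.+1 + h by rewrite /u -natr1; ring.
(* On [[u j.+1, u j]] the value of [g] is smallest at the right end [u j], so [g (u j)] may replace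
   [g r] in the denominator. *)
have step z j : s <= z <= t -> (j < n)%N ->
    S (u j) z - S (u j.+1) z <= (c * (g z / g (u j) - 1) + k * M) * h.
  move=> zst jn.
  have /andP[su ut] := u_in _ (ltnW jn); have /andP[su' ut'] := u_in _ jn.
  have -> : h = u j - u j.+1 by rewrite (uS j); ring.
  have uu : u j.+1 <= u j by rewrite (uS j) lerDl ltW.
  have Iz := sub _ zst.
  apply: (@upper_dini_mean_value _ (S^~ z)) => // r /andP[ur ru].
    by apply: S_cont => //; apply: sub; rewrite (le_trans su')// (le_trans ru).
  have rst : s <= r <= t by rewrite (le_trans su')// (le_trans (ltW ru)).
  have Ir := sub _ rst.
  apply: upper_dini_le_weaken (S_evi Ir (lt_le_trans ru (le_trans ut tb)) Iz).
  rewrite lerD// ler_wpM2l// ?(ltW c_gt0) ?S_le_M'// lerD2r.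
  have Iu : I (u j) by exact: sub (u_in _ (ltnW jn)).
  rewrite ler_wpM2l ?(ltW (g_gt0 _))// lef_pV2 ?posrE ?g_gt0//.
  by apply: g_noninc => //; exact: ltW.
have tel z m : s <= z <= t -> (m <= n)%N -> S (u 0%N) z - S (u m) z <=
    \sum_(j < m) (c * (g z / g (u j) - 1) + k * M) * h.
  move=> zst; elim: m => [|m IH] mn; first by rewrite big_ord0 subrr.
  rewrite big_ord_recr/=; have := IH (ltnW mn); have := step z m zst mn; lra.
have sst : s <= s <= t by rewrite lexx.
have tst : s <= t <= t by rewrite lexx andbT.
have u0 : u 0%N = t by rewrite /u mul0r subr0.
have := lerD (tel _ _ sst (leqnn n)) (tel _ _ tst (leqnn n)).
rewrite u0 -/s -[u n]/s (Sxx Is) (Sxx It) (S_sym Is It) -big_split/=.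
(* Here [g s + g t - 2 * g (u j)] is written as [e - 2 * (g (u j) - g t)]. *)
rewrite (_ : \sum_(j < n) _ = \sum_(j < n)
  ((c * h) * ((g (u j))^-1 * e - 2 * ((g (u j))^-1 * (g (u j) - g t))) +
   2 * k * M * h)); last first.
  apply: eq_bigr => j _; rewrite /e.
  have gu := g_gt0 (sub _ (u_in _ (ltnW (ltn_ord j)))).
  by field; rewrite gt_eqF.
rewrite big_split/= -mulr_sumr sumrB -mulr_suml -mulr_sumr.
rewrite sumr_const card_ord -[_ *+ n]mulr_natr.
have -> : 2 * k * M * h * n%:R =
    (c * h) * (4 * k * (g t)^-1 * e * n%:R ^+ 2 * h) by rewrite /M; ring.
rewrite -mulrDr => H.
have {H} : 0 <= c * h * (\sum_(i < n) (g (u i))^-1 * e -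
  2 * \sum_(i < n) (g (u i))^-1 * (g (u i) - g t) +
  4 * k * (g t)^-1 * e * n%:R ^+ 2 * h).
  by rewrite -mulr_suml; lra.
rewrite pmulr_rge0 ?mulr_gt0// -mulr_suml /u; lra.
Qed.

(** The times [t - j * h] with [h = t - s] extend the short interval [[s, t]] backwards to a length
    comparable to a fixed [d]. With weights [1 / g], [discrete_slope_bound] compares the drop of [g]
    over one step with its total drop over [m] steps, which is at most [g a]. *)
Lemma self_evi_energy_lipschitz a' : a < a' -> exists2 L, 0 <= L &
  forall s t, a' <= s -> s <= t -> t <= b -> g s - g t <= L * (t - s).
Proof.
move=> aa'; have [a'b|ba'] := leP a' b; last first.
  by exists 0 => // s t a's st tb; exfalso; lra.
have Ia : I a by rewrite /= lexx/=; lra.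
have Ib : I b by rewrite /= lexx andbT; lra.
have ga := g_gt0 Ia; have gb := g_gt0 Ib.
pose p := (g a)^-1; pose P := (g b)^-1.
have p0 : 0 < p by rewrite invr_gt0.
have P0 : 0 < P by rewrite invr_gt0.
(* [C * h] will be the perturbation constant of the discrete inequality, and [q * d <= 1 / 2] its
   smallness condition, since [m * h <= d]. *)
pose C := 4 * k * P / p.
have C0 : 0 <= C by rewrite /C divr_ge0 ?mulr_ge0 ?(ltW P0) ?(ltW p0).
pose q := 2 * C * P / p.
have q0 : 0 <= q by exact: divr_ge0 (mulr_ge0 (mulr_ge0 (ler0n _ _) C0) (ltW P0)) (ltW p0).
pose d := Num.min (a' - a) (1 / 2 / (q + 1)).
have d0 : 0 < d by rewrite lt_min subr_gt0 aa' !divr_gt0// ltr_wpDl.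
have da : d <= a' - a by rewrite ge_min lexx.
have qd : q * d <= 1 / 2.
  have : d <= 1 / 2 / (q + 1) by rewrite ge_min lexx orbT.
  rewrite ler_pdivlMr ?ltr_wpDl//; nra.
pose K := 8 * P ^+ 2 / p ^+ 2 * g a.
have K0 : 0 <= K.
  by rewrite /K mulr_ge0 ?(ltW ga)// divr_ge0 ?mulr_ge0 ?exprn_ge0 ?(ltW P0) ?(ltW p0).
exists (g a / d + 2 * K / d).
  by rewrite addr_ge0 ?divr_ge0 ?(ltW ga) ?(ltW d0)// mulr_ge0.
move=> s t a's; rewrite le_eqVlt => /predU1P[->|st tb].
  by rewrite !subrr mulr0.
pose h := t - s; have h0 : 0 < h by rewrite subr_gt0.
rewrite -/h mulrDl.
have It : I t by rewrite /= tb andbT; lra.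
have Is : I s by apply/andP; split; lra.
have gt0 := g_gt0 It.
have gsa : g s <= g a by apply: g_noninc => //; lra.
(* For intervals longer than [d] the trivial bound [g s - g t <= g a] suffices. *)
have [dh|hd] := ltP d h.
  apply: (@le_trans _ _ (g a / d * h)); last first.
    by rewrite lerDl mulr_ge0 ?(ltW h0)// divr_ge0 ?(ltW d0)// mulr_ge0.
  rewrite mulrAC ler_pdivlMr//.
  apply: (@le_trans _ _ (g a * d)).
    by rewrite ler_wpM2r ?(ltW d0)//; lra.
  by rewrite ler_wpM2l ?(ltW ga)// ltW.
pose m := Num.truncn (d / h).
have /andP[mle mgt] : m%:R <= d / h < m.+1%:R.
  by apply: truncn_itv; rewrite divr_ge0// ltW.
have m0 : (0 < m)%N.
  by rewrite lt0n; apply/eqP => mE; move: mgt; rewrite mE ltr_pdivrMr// mul1r ltNge hd.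
have mh : m%:R * h <= d by rewrite -ler_pdivlMr.
(* Since [m >= 1], [d < m.+1 * h <= 2 * m * h]; this turns the gain of a factor [m] into a factor
   [h / d]. *)
have hm : d < 2 * m%:R * h.
  move: mgt; rewrite ltr_pdivrMr// => /lt_le_trans; apply.
  by rewrite ler_wpM2r ?(ltW h0)// -natrM ler_nat mul2n -addnn -addn1 leq_add2l.
have Iu j : (j <= m)%N -> I (t - j%:R * h).
  move=> jm; have : j%:R * h <= m%:R * h by rewrite ler_wpM2r ?(ltW h0)// ler_nat.
  have : 0 <= j%:R * h by rewrite mulr_ge0// ltW.
  by move=> ? ?; apply/andP; split; lra.
have slope : m%:R * (g s - g t) <=
    8 * P ^+ 2 / p ^+ 2 * (g (t - m%:R * h) - g t).
  have -> : s = t - 1%:R * h by rewrite /h; ring.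
  apply: (@discrete_slope_bound R (fun j => (g (t - j%:R * h))^-1)
    (fun j => g (t - j%:R * h) - g t) m p P (C * h)) => //=.
  - by rewrite mulr_ge0// ltW.
  - move=> j jm; rewrite /p lef_pV2 ?posrE ?g_gt0//; last exact: Iu.
    by apply: g_noninc => //; [exact: Iu|have /andP[] := Iu _ jm].
  - move=> j jm; rewrite /P lef_pV2 ?posrE ?g_gt0//; last exact: Iu.
    by apply: g_noninc => //; [exact: Iu|have /andP[] := Iu _ jm].
  - move=> j jm; have Ij := Iu _ (ltnW jm); have IjS := Iu _ jm.
    rewrite lef_pV2 ?posrE ?g_gt0//; apply: g_noninc => //.
    by rewrite lerD2l lerN2 ler_wpM2r ?(ltW h0)// ler_nat.
  - move=> j jm; rewrite subr_ge0; apply: g_noninc => //; first exact: Iu.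
    by rewrite gerBl mulr_ge0// ltW.
  - by rewrite mul0r subr0 subrr.
  - move=> n n0 nm; have In := Iu _ nm.
    have an : a <= t - n%:R * h by case/andP: In.
    apply: le_trans (self_evi_hermite_hadamard n0 h0 tb an) _.
    set e := g (t - _) - _; set W := \sum_(j < n) _.
    have e0 : 0 <= e.
      by rewrite subr_ge0 g_noninc// gerBl mulr_ge0// ltW.
    have Wn : p * n%:R <= W.
      rewrite mulr_natr -[n in leLHS]card_ord -sumr_const ler_sum// => j _.
      have jm : (j <= m)%N by exact: leq_trans (ltnW (ltn_ord j)) nm.
      rewrite lef_pV2 ?posrE ?g_gt0//; last exact: Iu.
      by apply: g_noninc => //; [exact: Iu|have /andP[] := Iu _ jm].
    rewrite (mulrDr (e * W)) mulr1 lerD2l.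
    have -> : e * W * (C * h * n%:R) = C * W * (e * n%:R * h) by ring.
    have -> : 4 * k * (g t)^-1 * e * n%:R ^+ 2 * h =
      4 * k * (g t)^-1 * n%:R * (e * n%:R * h) by ring.
    rewrite ler_wpM2r ?mulr_ge0 ?(ltW h0)//.
    (* The error has no factor [W]; it is recovered from [p * n <= W], which explains the division
       by [p] in [C]. *)
    apply: (@le_trans _ _ (C * (p * n%:R))); last by rewrite ler_wpM2l.
    have -> : C * (p * n%:R) = 4 * k * P * n%:R by rewrite /C; field; rewrite gt_eqF.
    rewrite ler_wpM2r// ler_wpM2l ?mulr_ge0//.
    by rewrite lef_pV2 ?posrE// g_noninc.
  - have -> : 2 * (C * h) * P / p * m%:R = q * (m%:R * h) by rewrite /q; ring.
    by apply: le_trans qd; rewrite ler_wpM2l.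
have gm : g (t - m%:R * h) - g t <= g a.
  have : g (t - m%:R * h) <= g a.
    by apply: g_noninc => //; [exact: Iu|have /andP[] := Iu _ (leqnn m)].
  lra.
have slopeK : m%:R * (g s - g t) <= K.
  by apply: le_trans slope _; rewrite /K ler_wpM2l// divr_ge0 ?mulr_ge0 ?exprn_ge0 ?(ltW P0) ?(ltW p0).
apply: (@le_trans _ _ (2 * K / d * h)); last first.
  by rewrite lerDr mulr_ge0 ?(ltW h0)// divr_ge0 ?(ltW ga) ?(ltW d0).
have -> : 2 * K / d * h = (2 * h * K) / d by ring.
rewrite ler_pdivlMr//.
have gst : 0 <= g s - g t by rewrite subr_ge0 g_noninc// ltW.
apply: (@le_trans _ _ ((g s - g t) * (2 * m%:R * h))).
  by rewrite ler_wpM2l// ltW.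
have -> : (g s - g t) * (2 * m%:R * h) = 2 * h * (m%:R * (g s - g t)) by ring.
by rewrite ler_wpM2l// mulr_ge0// ltW.
Qed.

(** In [self_evi_speed] the factor [g s / g t - 1] is itself of order [t - s] by the Lipschitz bound
    on [g]. *)
Lemma self_evi_quadratic a' : a < a' -> exists L,
  forall s t, a' <= s -> s <= t -> t <= b -> S t s <= L * (t - s) ^+ 2.
Proof.
move=> aa'; have [L L0 gL] := self_evi_energy_lipschitz aa'.
exists (2 * c * (g b)^-1 * L) => s t a's st tb.
have It : I t by rewrite /= tb andbT; lra.
have Is : I s by apply/andP; split; lra.
have Ib : I b by rewrite /= lexx andbT; lra.
have gt0 := g_gt0 It; have gb0 := g_gt0 Ib.
apply: le_trans (self_evi_speed Is It st) _.
have -> : 2 * (c * (g s / g t - 1)) * (t - s) =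
  2 * c * (t - s) * ((g t)^-1 * (g s - g t)) by field; rewrite gt_eqF.
have -> : 2 * c * (g b)^-1 * L * (t - s) ^+ 2 =
  2 * c * (t - s) * ((g b)^-1 * (L * (t - s))) by ring.
rewrite ler_wpM2l//.
  by rewrite !mulr_ge0 ?(ltW c_gt0)// subr_ge0.
apply: ler_pM; rewrite ?invr_ge0 ?(ltW gt0)//.
- by rewrite subr_ge0 g_noninc.
- by rewrite lef_pV2// g_noninc.
- exact: gL.
Qed.

End SelfEVI.

(** * Continuity and linear lower bounds for the comparison function *)

Section Comparison.
Context {R : realType}.
Implicit Types (K N x theta : R).

Lemma sKN0 K N : sKN K N 0 = 0.
Proof.
by rewrite /sKN /sinh !mul0r sin0 oppr0 subrr !mul0r; case: ifP => //; case: ifP.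
Qed.

Lemma continuous_sKN K N : continuous (sKN K N).
Proof.
rewrite /sKN => x.
have [_|_] := boolP (K < 0); last have [_|_] := boolP (K == 0); rewrite /=.
- apply: cvgMr_tmp.
  apply: (@continuous_cvg _ _ _ (nbhs x) _ (fun theta => theta * _) sin).
    exact: continuous_sin.
  by apply: cvgMr_tmp; exact: cvg_id.
- exact: cvg_id.
have expc c : (fun theta => expR (theta * c)) @ x --> expR (x * c).
  apply: (@continuous_cvg _ _ _ (nbhs x) _ (fun theta => theta * c) expR).
    exact: continuous_expR.
  by apply: cvgMr_tmp; exact: cvg_id.
rewrite /sinh; apply: cvgMr_tmp; apply: cvgMr_tmp.
apply: cvgB; first exact: expc.
by under eq_fun do rewrite -mulrN; rewrite -mulrN; exact: expc.
Qed.

(** By the mean value theorem, since [cos] is at least [cos 1] on [[0, 1]]. *)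
Lemma sin_ge_linear x : 0 <= x <= 1 -> cos 1 * x <= sin x.
Proof.
move=> /andP[x0 x1].
have [|r] := @MVT_segment R sin cos 0 x x0 (fun r _ => is_derive_sin r).
  by apply: continuous_subspaceT => r; exact: continuous_sin.
rewrite in_itv/= sin0 !subr0 => /andP[r0 rx] ->.
rewrite ler_wpM2r// leNgt; apply/negP => h.
have pi2 : 2 <= pi :> R by exact: pi_ge2.
have in1 : 1 \in `[0, pi : R] by rewrite in_itv/= ler01/=; lra.
have inr : r \in `[0, pi : R] by rewrite in_itv/= r0/=; lra.
by move: h; rewrite ltr_cos// ltNge (le_trans rx).
Qed.

Lemma sinh_ge_linear x : 0 <= x -> x / 2 <= sinh x.
Proof.
move=> x0; rewrite /sinh ler_pM2r ?invr_gt0// expRN.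
have := expR_ge1Dx x; set E := expR x => hE.
have E0 : 0 < E by exact: expR_gt0.
suff : E^-1 <= 1 by lra.
rewrite invf_le1//; lra.
Qed.

(** Turns bounds on [sKN] of half a distance into bounds on the distance. The radius [rho] also
    ensures that the inequality may be tested when [K < 0]. *)
Lemma sKN_ge_linear K N : N < 0 -> exists rho c0, [/\ 0 < rho, 0 < c0,
  K < 0 -> rho <= pi * Num.sqrt (N / K) &
  forall x, 0 <= x -> x < rho -> c0 * x <= sKN K N (x / 2)].
Proof.
move=> N0; have [K0|K0|K0] := ltgtP K 0; last first.
- exists 1, (1 / 2); split; [by []|lra|by []|].
  by move=> x _ _; rewrite /sKN K0 ltxx eqxx; lra.
- pose s := Num.sqrt (- K / N).
  have s0 : 0 < s by rewrite sqrtr_gt0 mulNr -mulrN mulr_gt0// oppr_gt0 invr_lt0.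
  exists 1, (1 / 4); split; [by []|lra|by []|].
  move=> x x0 _; rewrite /sKN (lt_gtF K0) gt_eqF// -/s ler_pdivlMr//.
  have := @sinh_ge_linear (x / 2 * s); rewrite !mulr_ge0 ?(ltW s0)// => /(_ isT).
  by apply: le_trans; lra.
- pose s := Num.sqrt (K / N).
  have KN : 0 < K / N by rewrite nmulr_rgt0// invr_lt0.
  have s0 : 0 < s by rewrite sqrtr_gt0.
  have sV : Num.sqrt (N / K) = s^-1.
    by rewrite -invf_div sqrtrV// ltW.
  (* With this radius the argument of [sin] stays below 1, and [2 <= pi] gives the bound on
     [rho]. *)
  exists (2 / s), (cos 1 / 2); split => //; rewrite ?divr_gt0 ?cos1_gt0//.
    by move=> _; rewrite sV ler_pM2r ?invr_gt0// pi_ge2.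
  move=> x x0; rewrite /sKN K0 -/s ltr_pdivlMr// => xs; rewrite ler_pdivlMr//.
  have := @sin_ge_linear (x / 2 * s).
  have : 0 <= x * s by rewrite mulr_ge0// ltW.
  move=> xs0 /(_ _)/wrap[]; first by apply/andP; split; lra.
  by apply: le_trans; lra.
Qed.

End Comparison.

(** * Upper right derivatives, the time interval and distances along a curve *)

Lemma upper_right_derivative_dini {R : realType} (phi : R -> R) (r B : R) :
  (upper_right_derivative phi r <= B%:E)%E -> upper_dini_le phi r B.
Proof.
move=> dB e e0.
have : (upper_right_derivative phi r < (B + e)%:E)%E.
  by apply: le_lt_trans dB _; rewrite lte_fin ltrDl.
(* The limsup is an infimum of suprema over right neighbourhoods of 0, so some [V] has its supremum
   below [B + e]. *)
move=> /ereal_inf_lt[_ [V FV <-]] supV.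
near=> h.
have h0 : 0 < h by [].
have Vh : V h by near: h.
rewrite -ler_pdivrMr// -lee_fin; apply: le_trans (ltW supV).
by apply: ereal_sup_ubound; exists h.
Unshelve. all: by end_near. Qed.

Lemma time_interval_nbhs {R : realType} (T : \bar R) (t : R) :
  time_interval T t -> nbhs t (time_interval T).
Proof.
move=> [t0]; case: T => [T| |//]; rewrite /time_interval/=.
- rewrite lte_fin => tT; near=> s; split.
    by near: s; exact: lt_nbhsr.
  by rewrite lte_fin; near: s; exact: lt_nbhsl.
- by move=> _; near=> s; split; [near: s; exact: lt_nbhsr|rewrite ltry].
Unshelve. all: by end_near. Qed.

Lemma time_interval_convex {R : realType} (T : \bar R) (s t r : R) :
  time_interval T s -> time_interval T t -> s <= r <= t -> time_interval T r.
Proof.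
move=> [s0 _] [_ tT] /andP[sr rt]; split; first exact: lt_le_trans sr.
by apply: le_lt_trans tT; rewrite lee_fin.
Qed.

Lemma continuous_mdistl {R : realType} (X : metricType R) (y : R -> X) (z : X) t :
  {for t, continuous y} -> {for t, continuous (fun r => mdist (y r) z)}.
Proof.
move=> yc; apply/cvgrPdist_le => /= e e0.
have near_t : \forall r \near t, mdist (y t) (y r) <= e.
  exact: metricType_numDomainType.cvgr_dist_le yc _ e0.
near=> r; have yr : mdist (y t) (y r) <= e by near: r.
have := metric_triangle (y t) (y r) z; have := metric_triangle (y r) (y t) z.
rewrite (metric_sym (y r) (y t)) ler_norml => *; apply/andP; split; lra.
Unshelve. all: by end_near. Qed.

(** * Monotonicity of the energy and Lipschitz regularity of the curve *)

Section EVICurve.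
Context {R : realType} {X : metricType R}.
Variables (f : X -> \bar R) (K N : R) (T : \bar R) (y : R -> X).
Hypotheses (f_lsc : lower_semicontinuous f) (N_lt0 : N < 0).
Hypothesis y_EVI : EVI_gradient_curve f K N T y.

Local Notation I := (time_interval T).

Let F t := fine (f (y t)).
Let G t := expR (- F t / N).
Let S r s := sKN K N (mdist (y r) (y s) / 2) ^+ 2.

Let G_gt0 t : 0 < G t. Proof. exact: expR_gt0. Qed.

Let G_le r s : (G r <= G s) = (F r <= F s).
Proof. by rewrite ler_expR ler_ndivrMr// divfK ?lt_eqF// lerN2. Qed.

Let fF t : I t -> f (y t) = (F t)%:E.
Proof. by case: y_EVI => _ dom_y _ /dom_y fin; rewrite fineK. Qed.

Let S_sym r s : S r s = S s r.
Proof. by rewrite /S metric_sym. Qed.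

Let Sxx r : S r r = 0.
Proof. by rewrite /S mdistxx mul0r sKN0 expr0n. Qed.

Let S_cont r s : I r -> {for r, continuous (S^~ s)}.
Proof.
case: y_EVI => yc _ _ /yc {}yc; rewrite /S.
have h : {for r, continuous (fun r => sKN K N (mdist (y r) (y s) / 2))}.
  apply: (@continuous_cvg _ _ _ (nbhs r) _ (fun r => mdist (y r) (y s) / 2)).
    exact: continuous_sKN.
  by apply: cvgMr_tmp; exact: continuous_mdistl.
exact: (cvgM h h).
Qed.

(** The form required by the abstract argument, with [c = - N / 2] and [k] the absolute value of
    [K], so that the sign of [K] no longer matters. *)
Let S_evi r s : I r -> I s ->
  (K < 0 -> mdist (y r) (y s) < pi * Num.sqrt (N / K)) ->
  upper_dini_le (S^~ s) r (- N / 2 * (G s / G r - 1) + `|K| * S r s).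
Proof.
move=> Ir Is small; apply: upper_right_derivative_dini.
case: y_EVI => _ _ /(_ (y s) r) evi.
have doms : dom_star f (y s) by rewrite /dom_star/= fF// ltry.
have := evi doms Ir small; rewrite -leeBrDr//; move/le_trans; apply.
rewrite /fN !fF// inver gt_eqF ?expR_gt0//= -/(S r s).
have -> : ((N / 2)%:E * (1 - (G s / G r)%:E) - (K * S r s)%:E =
    (N / 2 * (1 - G s / G r) - K * S r s)%:E)%E by [].
rewrite lee_fin.
have : - K * S r s <= `|K| * S r s.
  by rewrite ler_wpM2r ?sqr_ge0// -normrN ler_norm.
rewrite -/(G s) -/(G r); lra.
Qed.

Let F_lsc t x : I t -> x < F t -> \forall r \near t, x < F r.
Proof.
move=> It xF; have [V Vt VF] := f_lsc (x := y t) (a := x) (ltac:(by rewrite fF// lte_fin)).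
have [yc _ _] := y_EVI.
have yV : \forall r \near t, V (y r) by exact: yc.
near=> r; have Ir : I r by near: r; exact: time_interval_nbhs.
have : (x%:E < f (y r))%E by apply: VF; near: r.
by rewrite fF.
Unshelve. all: by end_near. Qed.

(* If the energy at [t] exceeded the one at [s < t], let [q] be the last time
   before [t] at which it does not exceed the energy at [s]. The evolution
   variational inequality tested against [y q] then forces the curve to stay at
   [y q] for a short time after [q]. *)
Let F_noninc s t : I s -> I t -> s <= t -> F t <= F s.
Proof.
move=> Is It st; rewrite leNgt; apply/negP => Fst.
pose E := [set r | s <= r <= t /\ F r <= F s].
have Es : E s by split; rewrite ?lexx ?st.
have supE : has_sup E by split; [exists s|exists t => r [/andP[]]].
pose q := sup E.
have sq : s <= q by apply: ub_le_sup Es; exact: supE.2.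
have qt : q <= t by apply: ge_sup; [exact: supE.1|move=> r [/andP[]]].
have Iq : I q by apply: time_interval_convex Is It _; rewrite sq.
have Fq : F q <= F s.
  rewrite leNgt; apply/negP => /(F_lsc Iq)[z /= z0 Fz].
  have [r Er qr] := sup_adherent z0 supE.
  have rq : r <= q by apply: ub_le_sup Er; exact: supE.2.
  have := Fz r; rewrite /ball_/= ger0_norm ?subr_ge0// ltrBlDr -ltrBlDl => /(_ qr).
  by case: Er => _; rewrite leNgt => /negP.
have {}qt : q < t.
  by rewrite lt_neqAle qt andbT; apply: contraTneq Fq => ->; rewrite -ltNge.
have Fgt r : q < r -> r <= t -> F s < F r.
  move=> qr rt; rewrite ltNge; apply/negP => Fr.
  have : E r by split=> //; rewrite rt (le_trans sq) ?ltW.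
  by move=> /(ub_le_sup supE.2); rewrite -/q leNgt qr.
have [rho [c0 [rho0 c00 rho_pi sKN_ge]]] := sKN_ge_linear K N_lt0.
have [yc _ _] := y_EVI.
have := metricType_numDomainType.cvgr_dist_lt (yc _ Iq) rho0.
move=> [z /= z0 near_q].
pose b := q + Num.min (t - q) (Num.min (z / 2) (1 / 2 / (`|K| + 1))).
have K1 : 0 < `|K| + 1 by rewrite ltr_wpDl.
have qb : q < b.
  by rewrite ltrDl !lt_min subr_gt0 qt !divr_gt0.
have bt : b <= t by rewrite -lerBrDl ge_min lexx.
have bz : b - q <= z / 2 by rewrite /b addrC addKr !ge_min lexx !orbT.
have bK : `|K| * (b - q) <= 1 / 2.
  have : b - q <= 1 / 2 / (`|K| + 1) by rewrite /b addrC addKr !ge_min lexx !orbT.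
  rewrite ler_pdivlMr//; have : 0 <= b - q by rewrite subr_ge0 ltW.
  have := normr_ge0 K; nra.
have Ib : I b by apply: time_interval_convex Iq It _; rewrite ltW.
have Isub r : q <= r <= b -> I r by exact: time_interval_convex.
have dist_rho r : q <= r <= b -> mdist (y r) (y q) < rho.
  move=> /andP[qr rb]; rewrite metric_sym; apply: near_q => /=.
  rewrite distrC ger0_norm ?subr_ge0//; lra.
(* After [q] the energy is at least [F q], so the driving term is nonpositive and Gronwall applies
   with [A = 0]. *)
have : S b q <= 2 * 0 * (b - q).
  apply: (@upper_dini_gronwall _ (S^~ q) q b 0 `|K|) => //.
  - exact: ltW.
  - by move=> r /Isub; exact: S_cont.
  - move=> r /andP[qr rb].
    have qrb : q <= r <= b by rewrite qr ltW.
    apply: upper_dini_le_weaken (S_evi (Isub _ qrb) Iq _); last first.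
      by move=> K0; apply: lt_le_trans (rho_pi K0); exact: dist_rho.
    rewrite lerD2r mulr_ge0_le0//; first by rewrite divr_ge0// oppr_ge0 ltW.
    rewrite subr_le0 ler_pdivrMr// mul1r G_le.
    move: qr; rewrite le_eqVlt => /predU1P[->//|qr].
    by rewrite ltW// (le_lt_trans Fq)// Fgt// (le_trans (ltW rb)).
  - by move=> r _; exact: sqr_ge0.
have qbb : q <= b <= b by rewrite lexx andbT ltW.
rewrite mulr0 mul0r /S => S0.
have sKN0 : sKN K N (mdist (y b) (y q) / 2) = 0.
  by apply/eqP; rewrite -sqrf_eq0 eq_le S0 sqr_ge0.
have := sKN_ge (mdist (y b) (y q)) (mdist_ge0 _ _) (dist_rho _ qbb).
rewrite sKN0 pmulr_rle0// => d0.
have yb : y b = y q by apply: mdist_positivity; apply/eqP; rewrite eq_le d0 mdist_ge0.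
by have := Fgt b qb bt; rewrite /F yb ltNge Fq.
Qed.

(** On a short window around [t] the quadratic bound on [S] holds; its square root and the linear
    lower bound on [sKN] give the Lipschitz estimate. *)
Lemma EVI_curve_locally_lipschitz : locally_lipschitz_on I y.
Proof.
move=> t It.
have [rho [c0 [rho0 c00 rho_pi sKN_ge]]] := sKN_ge_linear K N_lt0.
have [yc _ _] := y_EVI.
have := time_interval_nbhs It; move=> [z1 /= z10 near_I].
(* Radius [rho / 2] around [y t] keeps any two points of the window within [rho] of each other. *)
have := metricType_numDomainType.cvgr_dist_lt (yc _ It) (divr_gt0 rho0 (ltr0n _ 2)).
move=> [z /= z0 near_t].
have K1 : 0 < `|K| + 1 by rewrite ltr_wpDl.
pose d := Num.min (z1 / 2) (Num.min (z / 2) (1 / 4 / (`|K| + 1))).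
have d0 : 0 < d by rewrite !lt_min !divr_gt0.
have dz1 : d <= z1 / 2 by rewrite !ge_min lexx.
have dz : d <= z / 2 by rewrite !ge_min lexx !orbT.
have dK : `|K| * (t + d - (t - d)) <= 1 / 2.
  have : d <= 1 / 4 / (`|K| + 1) by rewrite !ge_min lexx !orbT.
  rewrite ler_pdivlMr//; have := normr_ge0 K; nra.
have norm_lt r : t - d <= r <= t + d -> `|t - r| <= d.
  by move=> /andP[? ?]; rewrite ler_norml; apply/andP; split; lra.
have Isub r : t - d <= r <= t + d -> I r.
  move=> /norm_lt rd; apply: near_I => /=; lra.
have dist_rho r s : t - d <= r <= t + d -> t - d <= s <= t + d ->
    mdist (y r) (y s) < rho.
  move=> /norm_lt rd /norm_lt sd.
  have tr : mdist (y t) (y r) < rho / 2 by apply: near_t => /=; lra.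
  have ts : mdist (y t) (y s) < rho / 2 by apply: near_t => /=; lra.
  have := metric_triangle (y r) (y t) (y s); rewrite (metric_sym (y r) (y t)); lra.
have [] := @self_evi_quadratic R S G (t - d) (t + d) (- N / 2) `|K|
  _ (normr_ge0 K) dK _ _ _ _ _ _ _ (t - d / 2).
- by rewrite divr_gt0// oppr_gt0.
- by move=> r s _ _; exact: sqr_ge0.
- by move=> r _; exact: Sxx.
- by move=> r s _ _; exact: S_sym.
- by move=> r s Ir _; exact/S_cont/Isub.
- by move=> r _; exact: G_gt0.
- by move=> r s Ir Is rs; rewrite G_le F_noninc//; exact: Isub.
- move=> r s Ir _ Is; apply: S_evi; [exact: Isub|exact: Isub|].
  by move=> K0; apply: lt_le_trans (rho_pi K0); exact: dist_rho.
- lra.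
move=> L S_le.
(* The square of [1 + |L|] dominates [L] whatever its sign, so no square root of [L] is needed. *)
pose M := (1 + `|L|) / c0.
have M0 : 0 < M by rewrite divr_gt0// ltr_pwDl.
have lip r s : t - d / 2 <= r -> r <= s -> s <= t + d ->
    mdist (y s) (y r) <= M * (s - r).
  move=> tr rs st.
  have Wr : t - d <= r <= t + d by apply/andP; split; lra.
  have Ws : t - d <= s <= t + d by apply/andP; split; lra.
  have ge := sKN_ge _ (mdist_ge0 _ _) (dist_rho _ _ Ws Wr).
  have rs0 : 0 <= s - r by rewrite subr_ge0.
  rewrite -(ler_pM2l c00) (_ : c0 * (M * (s - r)) = (1 + `|L|) * (s - r)); last first.
    by rewrite /M; field; rewrite gt_eqF.
  apply: le_trans ge _.
  rewrite leNgt; apply/negP => lt.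
  have : ((1 + `|L|) * (s - r)) ^+ 2 < S s r.
    have Lrs0 : 0 <= (1 + `|L|) * (s - r) by rewrite mulr_ge0// addr_ge0.
    by rewrite /S ltr_pXn2r// nnegrE//; exact: le_trans Lrs0 (ltW lt).
  apply/negP; rewrite -leNgt; apply: le_trans (S_le _ _ tr rs st) _.
  rewrite exprMn ler_wpM2r ?sqr_ge0//.
  have := ler_norm L; have := normr_ge0 L; nra.
exists M, [set r | `|t - r| < d / 2]; split.
  by exists (d / 2) => //=; rewrite divr_gt0.
move=> r s [/= rt _] [/= st _].
wlog rs : r s rt st / r <= s.
  move=> h; have [rs|/ltW sr] := leP r s; first exact: h.
  by rewrite metric_sym distrC; exact: h.
move: rt st; rewrite !ltr_norml => /andP[? ?] /andP[? ?].
by rewrite metric_sym distrC ger0_norm ?subr_ge0//; apply: lip => //; lra.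
Qed.

End EVICurve.

Theorem proposition4p3 (R : realType) (X : metricType R)
    (X_intrinsic : strictly_intrinsic X)
    (X_completion : has_geodesic_completion X)
    (f : X -> \bar R)
    (f_proper : dom f !=set0)
    (f_dense : dense (dom f))
    (f_lsc : lower_semicontinuous f)
    (K N : R) (N_lt0 : N < 0)
    (T : \bar R) (T_gt0 : (0 < T)%E)
    (y : R -> X) (y_EVI : EVI_gradient_curve f K N T y) :
  locally_lipschitz_on (time_interval T) y.
Proof. exact: EVI_curve_locally_lipschitz f_lsc N_lt0 y_EVI. Qed.
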